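(* Let $J \subseteq \mathbb{R}$ be a non-degenerate interval and let $f:J\to\mathbb{R}$ be continuous. Let $C\geq 0$ be a real number, and suppose that the set $E_C(f)=\{x\in J: L(f,x)>C\}$ is non-empty. Then $E_C(f)$ has a perfect subset.
   Context: For a non-degenerate interval $J\subseteq\mathbb{R}$, a function $f:J\to\mathbb{R}$ and a point $x_0\in J$, the pointwise Lipschitz constant of $f$ at $x_0$ is \[ L(f,x_0)=\limsup_{x\to x_0}\frac{|f(x)-f(x_0)|}{|x-x_0|}\in[0,\infty], \] where the limsup is taken over $x\in J\setminus\{x_0\}$ (so it is one-sided if $x_0$ is an endpoint of $J$). A subset $A$ of $\mathbb{R}$ is a perfect set if $A$ is non-empty and closed in $\mathbb{R}$, and $A$ has no isolated points. (In particular, perfect sets are non-empty by convention.) *)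

(* Defs.v *)
From mathcomp Require Import all_boot all_order all_algebra.
From mathcomp Require Import all_classical all_reals all_analysis.

Set Implicit Arguments.
Unset Strict Implicit.
Unset Printing Implicit Defensive.

Import Order.TTheory GRing.Theory Num.Theory.
Import numFieldNormedType.Exports.

Local Open Scope classical_set_scope.
Local Open Scope ring_scope.

(* A function J -> R is represented by a total function R -> R; the limsup is
   along the punctured neighbourhoods of x0 restricted to J, so neither the
   values of f outside J nor the quotient at x = x0 (0 / 0) matter. *)
Definition pointwise_lip (R : realType) (J : set R) (f : R -> R) (x0 : R)
    : \bar R :=
  limf_esup (fun x : R => (`|f x - f x0| / `|x - x0|)%:E) (within J x0^').

Definition lip_superlevel (R : realType) (J : set R) (f : R -> R) (C : R)
    : set R :=
  [set x | J x /\ (C%:E < pointwise_lip J f x)%E].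

(* The library's perfect_set allows the empty set. *)
Definition nonempty_perfect (R : realType) (A : set R) : Prop :=
  A !=set0 /\ perfect_set A.

(* Main.v *)
Require Import Defs.
From mathcomp Require Import all_boot all_order all_algebra.
From mathcomp Require Import all_classical all_reals all_analysis.
From mathcomp Require Import lra.

Import Order.TTheory GRing.Theory Num.Theory.
Import numFieldNormedType.Exports.

Local Open Scope classical_set_scope.
Local Open Scope ring_scope.

(* If L(f,x0) > C then |f(b) - f(a)| > k (b - a) for some a < b in J and some
   k > C; up to a sign, g(x) = f(x) - k x satisfies g(a) < g(b).  At a point
   x < b with g >= g(x) on [x,b], all slopes of f towards the right are at
   least k, so L(f,x) >= k > C.  The perfect set is the closure of the set of
   x in [a,b[ with g > g(x) on ]x,b] and g(x) < y, for a level y between g(a)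
   and g(b).  By the intermediate value theorem, the last point where g takes
   the value v is such an x for each v in [g(a),y[, and letting v decrease to
   g(x) shows that no x is isolated.  The bound g <= y < g(b) keeps b out of
   the closure. *)

(** The point [s] is the maximum of the compact set of [x] in [a, b] with g(x) <= v. The
    intermediate value theorem on [s, b] gives a point at level [v], which maximality forces to be
    [s]. *)
Lemma last_crossing (R : realType) (g : R -> R) (a b v : R) :
    continuous g -> a <= b -> g a <= v < g b ->
  exists s, [/\ a <= s, s < b, g s = v & forall t, s < t <= b -> v < g t].
Proof.
move=> cg leab /andP[gav vgb].
pose A := `[a, b] `&` (g @^-1` [set y | y <= v]).
have clA : closed (g @^-1` [set y | y <= v]).
  by apply: (continuous_closedP g).1 => //; exact: closed_le.
have cptA : compact A by exact/compact_closedI/clA/segment_compact.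
have A0 : A !=set0 by exists a; split => //=; rewrite in_itv /= lexx.
have cid : {within A, continuous (fun x : R => x)}.
  by apply: continuous_subspaceT => x; exact: cvg_id.
have [s] := compact_EVT_max A0 cptA cid.
rewrite inE => -[/=]; rewrite in_itv /= => /andP[leas lesb] gsv smax.
have right_gt t : s < t <= b -> v < g t.
  move=> /andP[st tb]; rewrite ltNge; apply/negP => gtv.
  suff : t <= s by rewrite leNgt st.
  apply: smax; rewrite inE; split => //=.
  by rewrite in_itv /= tb (ltW (le_lt_trans leas st)).
have [c] : exists2 c, c \in `[s, b]%R & g c = v.
  apply: IVT => //; first by apply: continuous_subspaceT => x; exact: cg.
  by rewrite ge_min gsv le_max (ltW vgb) orbT.
rewrite in_itv /= le_eqVlt => /andP[/orP[/eqP <-|sc] cb] gcv.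
  exists s; split => //; rewrite lt_neqAle lesb andbT.
  by apply: contraTneq vgb => <-; rewrite gcv ltxx.
by have := right_gt c; rewrite sc cb gcv ltxx => /(_ isT).
Qed.

Lemma perfect_closure (T : topologicalType) (A : set T) :
  A `<=` limit_point A -> perfect_set (closure A).
Proof.
move=> Alim; split; first exact: closed_closure.
rewrite eqEsubset; split.
  move=> x /subset_limit_point; rewrite -(closure_id _).1 //.
  exact: closed_closure.
move=> x clx U Ux.
have [y [Ay Uy]] := clx U Ux.
have [yx|yx] := eqVneq y x; last first.
  by exists y; split => //; exact: subset_closure.
rewrite yx in Ay; have [z [zx Az Uz]] := Alim x Ay U Ux.
by exists z; split => //; exact: subset_closure.
Qed.

Definition right_records {R : realType} (g : R -> R) (a b y : R) : set R :=
  [set x | [/\ a <= x, x < b, g x < y & forall t, x < t <= b -> g x < g t]].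

Lemma right_records_limit (R : realType) (g : R -> R) (a b y : R) :
    continuous g -> y < g b ->
  right_records g a b y `<=` limit_point (right_records g a b y).
Proof.
move=> cg ygb x [ax xb gxy gx] U /nbhs_ballP[e /= e0 eU].
(* On [c, b] the minimum of [g] exceeds g(x), so a level [v] just above g(x) is last attained before
   [c], hence within [e] of [x]. *)
pose c := Num.min b (x + e / 2).
have xc : x < c by rewrite lt_min xb ltrDl divr_gt0.
have cb : c <= b by rewrite ge_min lexx.
have [m] : exists2 m, m \in `[c, b]%R & forall t, t \in `[c, b]%R -> g m <= g t.
  by apply: EVT_min => //; apply: continuous_subspaceT => z; exact: cg.
rewrite in_itv /= => /andP[cm mb] gm.
have gxm : g x < g m by apply: gx; rewrite mb (lt_le_trans xc cm).
pose v := (g x + Num.min (g m) y) / 2.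
have gxmy : g x < Num.min (g m) y by rewrite lt_min gxm.
have [gxv vmy] : g x < v /\ v < Num.min (g m) y by rewrite /v; split; lra.
move: vmy; rewrite lt_min => /andP[vm vy].
have [s [xs sb gs sgt]] : exists s, [/\ x <= s, s < b, g s = v &
    forall t, s < t <= b -> v < g t].
  by apply: last_crossing => //; [exact: ltW|rewrite (ltW gxv) (lt_trans vy)].
exists s; split.
- by apply: contraTneq gxv => <-; rewrite gs ltxx.
- by split; rewrite ?gs ?(le_trans ax).
- apply: eU; rewrite /ball /= distrC ger0_norm ?subr_ge0// ltrBlDl.
  have : s < c.
    rewrite ltNge; apply/negP => cs.
    have : g m <= g s by apply: gm; rewrite in_itv /= cs ltW.
    by rewrite gs leNgt vm.
  by rewrite lt_min => /andP[_ /lt_trans]; apply; rewrite ltrD2l; lra.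
Qed.

(** Weak inequalities survive passage to the closure. The strict bound x < b is recovered from g(x)
    <= y < g(b). *)
Lemma closure_right_records (R : realType) (g : R -> R) (a b y x : R) :
    continuous g -> y < g b -> closure (right_records g a b y) x ->
  [/\ a <= x, x < b & forall t, x < t <= b -> g x <= g t].
Proof.
move=> cg ygb clx.
have in_closed (F : set R) : closed F -> right_records g a b y `<=` F -> F x.
  by move=> clF QF; move: clx => /(closureS QF); rewrite -(closure_id F).1.
have pre_closed w : closed (g @^-1` [set u | u <= w]).
  by apply: (continuous_closedP g).1 => //; exact: closed_le.
have xy : g x <= y.
  by apply: (in_closed (g @^-1` [set u | u <= y])) => // z [_ _ /ltW].
split.
- by apply: (in_closed [set z | a <= z]); [exact: closed_ge|move=> z []].
- rewrite lt_neqAle; apply/andP; split.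
    by apply: contraTneq xy => ->; rewrite -ltNge.
  by apply: (in_closed [set z | z <= b]); [exact: closed_le|move=> z [_ /ltW]].
- move=> t /andP[xt tb].
  (* For fixed [t], the implication from z < t to g(z) <= g(t) is a closed condition on [z] once
     written as this union. *)
  have : ([set z | t <= z] `|` g @^-1` [set u | u <= g t]) x.
    apply: in_closed; first by apply: closedU => //; exact: closed_ge.
    move=> z [_ _ _ gz]; have [tz|zt] := leP t z; [by left|right].
    by apply/ltW/gz; rewrite zt.
  by case=> //= tx; move: xt; rewrite ltNge tx.
Qed.

(** This extends [f] from [a, b] to a continuous function on the whole line, constant on each
    side. *)
Lemma continuous_clamp (R : realType) (f : R -> R) (a b : R) :
    a <= b -> {within `[a, b], continuous f} ->
  continuous (fun x => f (Num.max a (Num.min b x))).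
Proof.
move=> ab /subspace_continuousP cf x.
pose r (z : R) : R := Num.max a (Num.min b z).
have rab z : r z \in `[a, b]%R.
  by rewrite /= in_itv /= /r le_max lexx /= ge_max ab ge_min lexx.
have cr : r z @[z --> x] --> r x.
  apply: (@continuous_max R R (fun=> a) (fun z => Num.min b z)).
    exact: cvg_cst.
  by apply: (@continuous_min R R (fun=> b) id); [exact: cvg_cst|exact: cvg_id].
(* Continuity of [f] within [a, b] suffices, since the clamp [r] takes all its values there. *)
apply: (cvg_comp r f _ (cf (r x) (rab x))) => U /cr /= rU.
by apply: (@filterS _ (nbhs x) _ _ _ _ rU) => z; apply; exact: rab.
Qed.

Lemma perfect_slope (R : realType) (f : R -> R) (a b k : R) :
    a < b -> {within `[a, b], continuous f} -> k * (b - a) < f b - f a ->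
  exists2 P, nonempty_perfect P & forall x, P x ->
    [/\ a <= x, x < b & forall t, x < t <= b -> k * (t - x) <= f t - f x].
Proof.
move=> ab cf kab.
pose g x : R := f (Num.max a (Num.min b x)) - k * x.
have gE x : a <= x <= b -> g x = f x - k * x.
  by move=> /andP[ax xb]; rewrite /g (min_r xb) (max_r ax).
have cg : continuous g.
  move=> x; apply: cvgB; first exact: (continuous_clamp _ _ _ _ (ltW ab) cf).
  by apply: cvgM; [exact: cvg_cst|exact: cvg_id].
have gab : g a < g b by rewrite !gE ?lexx ?(ltW ab)//; lra.
pose y := (g a + g b) / 2.
have [gay ygb] : g a < y /\ y < g b by rewrite /y; split; lra.
exists (closure (right_records g a b y)).
  split; last exact/perfect_closure/right_records_limit.
  (* Non-emptiness: the last point at level g(a) is a right record. *)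
  have [s [as_ sb gs sgt]] : exists s, [/\ a <= s, s < b, g s = g a &
      forall t, s < t <= b -> g a < g t].
    by apply: last_crossing => //; [exact: ltW|rewrite lexx].
  by exists s; apply: subset_closure; split; rewrite ?gs.
move=> x clx; have [ax xb xrec] := closure_right_records _ _ _ _ _ _ cg ygb clx.
split => // t /andP[xt tb].
have := xrec t; rewrite xt tb !gE ?ax ?(ltW xb) ?tb ?(le_trans ax (ltW xt))//.
by move=> /(_ isT); lra.
Qed.

(** Every punctured neighbourhood of [x] in [J] meets ]x, b], so each supremum in the limsup is at
    least [k]. *)
Lemma pointwise_lip_ge (R : realType) (J : set R) (f : R -> R) (x b k : R) :
    x < b -> `[x, b] `<=` J ->
    (forall t, x < t <= b -> k * (t - x) <= `|f t - f x|) ->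
  (k%:E <= pointwise_lip J f x)%E.
Proof.
move=> xb xbJ slope; apply/ereal_infP => _ [V VF <-].
suff [t [xt tb Vt]] : exists t, [/\ x < t, t <= b & V t].
  apply: (@le_trans _ _ (`|f t - f x| / `|t - x|)%:E); last first.
    by apply: ereal_sup_ubound; exists t.
  have tx0 : 0 < t - x by rewrite subr_gt0.
  by rewrite lee_fin (gtr0_norm tx0) ler_pdivlMr// slope// xt.
have /nbhs_ballP[e /= e0 eV] := VF.
pose t := Num.min b (x + e / 2).
have xt : x < t by rewrite lt_min xb ltrDl divr_gt0.
have tb : t <= b by rewrite ge_min lexx.
exists t; split => //; apply: eV.
- rewrite /ball /= distrC gtr0_norm ?subr_gt0// ltrBlDl.
  by rewrite gt_min ltrD2l; apply/orP; right; lra.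
- by rewrite gt_eqF.
- by apply: xbJ; rewrite /= in_itv /= tb ltW.
Qed.

Lemma pointwise_lip_gt (R : realType) (J : set R) (f : R -> R) (C x : R) :
    (C%:E < pointwise_lip J f x)%E ->
  exists z, [/\ J z, z != x & C * `|z - x| < `|f z - f x|].
Proof.
move=> Clip.
have [_ [z [Jz zx] <-]] : exists2 y : \bar R,
    [set (`|f z - f x| / `|z - x|)%:E | z in [set z | J z /\ z != x]] y &
    (C%:E < y)%E.
  apply/ereal_sup_gtP/(lt_le_trans Clip)/ereal_inf_lbound.
  (* The limsup is an infimum of suprema, so it is at most the supremum over all of [J] without
     [x]. *)
  exists [set z | J z /\ z != x] => //.
  by apply: (@filterE _ (nbhs x)) => z zx Jz; split.
rewrite lte_fin ltr_pdivlMr ?normr_gt0 ?subr_eq0// => Cz.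
by exists z.
Qed.

Theorem theorem2p5 (R : realType) (J : set R) (f : R -> R) (C : R)
    (J_itv : is_interval J)
    (J_nondeg : exists a b : R, [/\ J a, J b & a < b])
    (f_cont : {within J, continuous f})
    (C_ge0 : 0 <= C)
    (E_neq0 : lip_superlevel J f C !=set0) :
  exists P : set R, nonempty_perfect P /\ P `<=` lip_superlevel J f C.
Proof.
have [x0 [Jx0 /pointwise_lip_gt[z0 [Jz0 z0x0 Cz0]]]] := E_neq0.
have [a [b [Ja Jb ab Cab]]] : exists a b, [/\ J a, J b, a < b &
    C * (b - a) < `|f b - f a|].
  move: z0x0; rewrite neq_lt => /orP[zx|xz].
    exists z0, x0; split => //; move: Cz0.
    by rewrite [`|z0 - x0|]distrC [`|f z0 - _|]distrC gtr0_norm ?subr_gt0.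
  by exists x0, z0; split => //; move: Cz0; rewrite gtr0_norm ?subr_gt0.
have abJ : `[a, b] `<=` J.
  by move=> x /=; rewrite in_itv /=; exact: J_itv.
have cf : {within `[a, b], continuous f} by exact: continuous_subspaceW f_cont.
have ba0 : 0 < b - a by rewrite subr_gt0.
(* Slopes at least [k] only give L(f,x) >= k, so [k] is taken strictly between [C] and the absolute
   slope of the chord. *)
pose k := (C + `|f b - f a| / (b - a)) / 2.
have Cq : C < `|f b - f a| / (b - a) by rewrite ltr_pdivlMr.
have Ck : C < k by rewrite /k; lra.
have kab : k * (b - a) < `|f b - f a| by rewrite -ltr_pdivlMr// /k; lra.
have [P [perfP slopeP]] : exists P, nonempty_perfect P /\ forall x, P x ->
    [/\ a <= x, x < b & forall t, x < t <= b -> k * (t - x) <= `|f t - f x|].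
  have [fab|fab] := leP 0 (f b - f a).
    have [|P ? slope] := perfect_slope _ f a b k ab cf.
      by rewrite -(ger0_norm fab).
    exists P; split => // x /slope[ax xb xt]; split => // t /xt /le_trans; apply.
    exact: ler_norm.
  (* If f(b) < f(a), pass to -f; the absolute value in [slopeP] hides the sign. *)
  have [||P ? slope] := perfect_slope _ (- f) a b k ab.
  - by move=> x; apply: cvgN; exact: cf.
  - by rewrite /= -opprD -(ltr0_norm fab).
  exists P; split => // x /slope[ax xb xt]; split => // t /xt /le_trans; apply.
  by rewrite /= -opprD -normrN ler_norm.
exists P; split => // x /slopeP[ax xb slope].
have xbJ : `[x, b] `<=` J.
  by move=> t /= t_xb; apply: abJ; apply: subset_itvr t_xb; rewrite bnd_simp.
split; first by apply: xbJ; rewrite /= in_itv /= lexx ltW.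
apply: lt_le_trans (pointwise_lip_ge _ _ _ _ _ _ xb xbJ slope).
by rewrite lte_fin.
Qed.
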